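(* Let $(H,\langle\cdot,\cdot\rangle)$ be a real Hilbert space, let $D\subseteq H$, let $A:H\to H$ be an operator (an arbitrary map), and let $T:D\to H$ be an operator which is strictly monotone relative to $A$. Then $T$ is injective on the set $$D\setminus\{x\in D: \exists y\in D,\ x\neq y,\ A(x)=A(y)\}.$$ Moreover, if $A$ is injective on $D$, that is, if for all $x,y\in D$ with $x\neq y$ one has $A(x)\neq A(y)$, then $T$ is injective on its whole domain $D$.
   Context: Given operators (maps) $T:D\subseteq H\to H$ and $A:H\to H$, $T$ is called monotone relative to $A$ if $\langle T(x)-T(y),A(x)-A(y)\rangle\ge 0$ for all $x,y\in D$; $T$ is called strictly monotone relative to $A$ if in addition equality in this inequality holds only for $A(x)=A(y)$. *)

(* Defs.v *)
From HB Require Import structures.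
From mathcomp Require Import all_boot all_order all_algebra sesquilinear.
From mathcomp Require Import all_classical all_reals topology normedtype.

Set Implicit Arguments.
Unset Strict Implicit.
Unset Printing Implicit Defensive.

Import Order.TTheory GRing.Theory Num.Theory.
Import numFieldNormedType.Exports.

Local Open Scope classical_set_scope.
Local Open Scope ring_scope.

(* A real Hilbert space is a complete normed module together with a real inner
   product (a symmetric positive definite bilinear form) inducing its norm; the
   latter condition is what makes completeness refer to the inner product. *)
Definition induces_norm (R : realType) (H : completeNormedModType R)
    (ip : {dot H for idfun}) : Prop :=
  forall x : H, `|x| = Num.sqrt (ip x x).

(* An operator T : D -> H is represented by a total map H -> H whose values
   outside D are never used. *)
Definition relatively_monotone (R : realType) (H : completeNormedModType R)
    (ip : {dot H for idfun}) (D : set H) (T A : H -> H) : Prop :=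
  forall x y, D x -> D y -> 0 <= ip (T x - T y) (A x - A y).

Definition strictly_relatively_monotone (R : realType)
    (H : completeNormedModType R) (ip : {dot H for idfun})
    (D : set H) (T A : H -> H) : Prop :=
  relatively_monotone ip D T A /\
  forall x y, D x -> D y -> ip (T x - T y) (A x - A y) = 0 -> A x = A y.

(* Main.v *)
Require Import Defs.
From HB Require Import structures.
From mathcomp Require Import all_boot all_order all_algebra sesquilinear.
From mathcomp Require Import all_classical all_reals topology normedtype.

Import Order.TTheory GRing.Theory Num.Theory.
Import numFieldNormedType.Exports.

Local Open Scope classical_set_scope.
Local Open Scope ring_scope.

(** If [T x = T y], then the inner product of [T x - T y] with [A x - A y] is zero, which is the
    equality case of monotonicity, so strictness forces [A x = A y]. Every collision of [T] on [D]
    is thus a collision of [A], and both claims follow by excluding collisions of [A]. *)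

Lemma strictly_relatively_monotone_eq (R : realType)
    (H : completeNormedModType R) (ip : {dot H for idfun}) (D : set H)
    (T A : H -> H) (x y : H) :
  strictly_relatively_monotone ip D T A ->
  D x -> D y -> T x = T y -> A x = A y.
Proof.
by move=> [_ hstrict] Dx Dy Txy; apply: hstrict => //; rewrite Txy subrr linear0l.
Qed.

Theorem proposition2p2 (R : realType) (H : completeNormedModType R)
    (ip : {dot H for idfun}) (hip : induces_norm ip)
    (D : set H) (A T : H -> H)
    (hT : strictly_relatively_monotone ip D T A) :
  set_inj (D `\` [set x | D x /\ exists y, [/\ D y, x <> y & A x = A y]]) T
  /\ (set_inj D A -> set_inj D T).
Proof.
split=> [x y /set_mem[Dx Nx] /set_mem[Dy _] Txy|injA x y xD yD Txy].
  (* If [x <> y], then [y] itself witnesses that [x] lies in the removed set, contradicting [Nx];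
     what remains is [A x = A y]. *)
  apply: contrapT => xy; apply: Nx; split=> //; exists y; split=> //.
  exact: strictly_relatively_monotone_eq hT Dx Dy Txy.
apply: injA => //.
exact: strictly_relatively_monotone_eq hT (set_mem xD) (set_mem yD) Txy.
Qed.
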